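(* Let $N$ be a prime, and for $g\in\mathbb{Z}/N\mathbb{Z}$ let $$f_g^{(N)}(\tau)=\begin{cases}-\dfrac{\ell_N}{n_N}E_2(\tau) & \text{if } g=e,\\[2mm] -\dfrac{\ell_N}{n_N}E_{2,N}(\tau)-\dfrac{N}{n_N}G_N(\tau) & \text{if } g\ne e,\end{cases}$$ with $\ell_N,n_N,E_{2,N},G_N$ as defined in the context. Then there exists a virtual graded $\mathbb{Z}/N\mathbb{Z}$-module $V^{(N)}=\bigoplus_{n\ge0}V^{(N)}_n$ such that for every $g\in\mathbb{Z}/N\mathbb{Z}$ $$f_g^{(N)}(\tau)=\sum_{n=0}^\infty \mathrm{tr}(g\mid V_n^{(N)})\,q^n .$$
   Context: Notation: $q=e^{2\pi i\tau}$ with $\tau$ in the upper half-plane; $E_2(\tau)=1-24\sum_{n\ge1}\sigma_1(n)q^n$; $\mathrm{num}(x)$ is the numerator of the positive rational $x$ in lowest terms; for $N$ prime $$n_N=\mathrm{num}\left(\tfrac{N-1}{12}\right),\quad \ell_N=\mathrm{num}\left(\tfrac{N^2-1}{24}\right),\quad E_{2,N}(\tau)=\frac{1}{(N+1)(N-1)}\left(N^2E_2(N\tau)-E_2(\tau)\right).$$ For $m\ge1$ let $\sigma_N(m)\in\mathbb{Z}$ be the $m$-th Fourier coefficient of $\frac1{24}(NE_2(N\tau)-E_2(\tau))$. The form $G_N$ is a fixed cusp form of weight $2$ on $\Gamma_0(N)$ with integer Fourier coefficients, given by $G_N=-g$ where $g=\sum_{m>0}c_g(m)q^m$ is a weight 2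 cusp form on $\Gamma_0(N)$ with integer coefficients such that $c_g(m)\equiv\sigma_N(m)\pmod{n_N}$ for all $m>0$ (such a $g$ is known to exist for every prime $N$; for $N=2,3$ it is $0$). A virtual graded $\mathbb{Z}/N\mathbb{Z}$-module $\bigoplus_nV_n$ is a sequence of virtual finite-dimensional complex representations $V_n$ (integer, possibly negative, combinations of irreducible representations), and $\mathrm{tr}(g\mid V_n)$ is the value of the virtual character at $g$. *)

(* Defs.v *)
From HB Require Import structures.
From mathcomp Require Import all_boot all_order all_algebra all_fingroup.
From mathcomp Require Import mxrepresentation.
From mathcomp Require Import complex.
From mathcomp Require Import all_classical all_reals all_analysis.

Set Implicit Arguments.
Unset Strict Implicit.
Unset Printing Implicit Defensive.

Import Order.TTheory GRing.Theory Num.Theory.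
Import numFieldNormedType.Exports.

Local Open Scope classical_set_scope.
Local Open Scope ring_scope.
Local Open Scope complex_scope.

(* [R[i]^o] is [R[i]] with the topology and normed module structure given by
   the complex modulus. *)

Section ModularForms.
Variable R : realType.

Definition upper (t : R[i]) : Prop := 0 < complex.Im t.

Definition cexp (z : R[i]) : R[i] :=
  (expR (complex.Re z))%:C *
  (cos (complex.Im z) +i* sin (complex.Im z)).

Definition qexp (t : R[i]) : R[i] := cexp ((2 * pi)%:C * 'i * t).

Definition has_qexp (f : R[i] -> R[i]) (a : nat -> R[i]) : Prop :=
  forall t, upper t ->
    (fun n => \sum_(0 <= k < n) a k * qexp t ^+ k : R[i]^o) @ \oo
      --> (f t : R[i]^o).

Definition fourier_coef (f : R[i] -> R[i]) (m : nat) (x : R[i]) : Prop :=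
  exists2 a : nat -> R[i], has_qexp f a & a m = x.

Definition mobius (A : 'M[int]_2) (t : R[i]) : R[i] :=
  ((A 0 0)%:~R * t + (A 0 1)%:~R) / ((A 1 0)%:~R * t + (A 1 1)%:~R).

Definition slash2 (f : R[i] -> R[i]) (A : 'M[int]_2) (t : R[i]) : R[i] :=
  ((A 1 0)%:~R * t + (A 1 1)%:~R) ^- 2 * f (mobius A t).

Definition in_SL2Z (A : 'M[int]_2) : Prop := \det A = 1.

Definition in_Gamma0 (N : nat) (A : 'M[int]_2) : Prop :=
  in_SL2Z A /\ (N%:Z %| A 1%R 0%R)%Z.

(* Every cusp is the image of infinity under some element of SL_2(Z), so
   vanishing at all cusps is a condition on all translates of [f]. *)
Record cusp_form2 (N : nat) (f : R[i] -> R[i]) : Prop := CuspForm2 {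
  cusp_form2_holo : forall t, upper t ->
    derivable (f : R[i]^o -> R[i]^o) t 1;
  cusp_form2_slash : forall A, in_Gamma0 N A ->
    forall t, upper t -> slash2 f A t = f t;
  cusp_form2_cusps : forall A, in_SL2Z A ->
    forall e : R, 0 < e -> exists B : R, forall t, upper t ->
      B <= complex.Im t -> `|slash2 f A t| <= e%:C }.

Definition sigma1 (n : nat) : nat := (\sum_(d <- divisors n) d)%N.

Definition E2 (t : R[i]) : R[i] :=
  1 - 24 * (\big[+%R/0]_(1 <= n <oo) ((sigma1 n)%:R * qexp t ^+ n : R[i]^o)).

Definition E2N (N : nat) (t : R[i]) : R[i] :=
  ((N%:R + 1) * (N%:R - 1))^-1 * (N%:R ^+ 2 * E2 (N%:R * t) - E2 t).

Definition nN (N : nat) : int := numq ((N%:R - 1) / 12).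

Definition lN (N : nat) : int := numq ((N%:R ^+ 2 - 1) / 24).

Definition is_sigmaN (N : nat) (s : nat -> int) : Prop :=
  forall m, (0 < m)%N ->
    fourier_coef (fun t => 24^-1 * (N%:R * E2 (N%:R * t) - E2 t)) m (s m)%:~R.

Definition is_GN (N : nat) (G : R[i] -> R[i]) : Prop :=
  exists (g : R[i] -> R[i]) (c s : nat -> int),
    [/\ cusp_form2 N g,
        c 0%N = 0 /\ has_qexp g (fun m => (c m)%:~R),
        is_sigmaN N s,
        forall m, (0 < m)%N -> (c m = s m %[mod nN N])%Z
      & forall t, upper t -> G t = - g t].

(* ['Z_N], for [N > 1], carries the multiplicative finite group structure
   whose law is addition modulo [N]; its identity element is [0]. *)
Definition fN (N : nat) (G : R[i] -> R[i]) (x : 'Z_N) (t : R[i]) : R[i] :=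
  if x == 0 then - ((lN N)%:~R / (nN N)%:~R) * E2 t
  else - ((lN N)%:~R / (nN N)%:~R) * E2N N t - (N%:R / (nN N)%:~R) * G t.

End ModularForms.

(* A virtual representation is an integer combination of irreducible ones. *)
Record virtual_rep (F : fieldType) (gT : finGroupType) (G : {group gT}) :=
  VirtualRep {
    vrep_size : nat;
    vrep_coef : 'I_vrep_size -> int;
    vrep_dim : 'I_vrep_size -> nat;
    vrep_repr : forall i, mx_representation F G (vrep_dim i);
    vrep_irr : forall i, mx_irreducible (vrep_repr i) }.

Definition vtrace (F : fieldType) (gT : finGroupType) (G : {group gT})
    (V : virtual_rep F G) (x : gT) : F :=
  \sum_(i < vrep_size V) (vrep_coef i)%:~R * \tr (vrep_repr i x).

(* Main.v *)
(* The virtual character taking the value a at the identity and b elsewhere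
   exists as soon as N divides a - b: it is b copies of the trivial character
   plus (a - b) / N copies of the regular one.  For m > 0 the m-th coefficients
   a of f_e and b of f_g satisfy
     n_N a = 24 l_N sigma(m),
     n_N b = e (N^2 sigma(m / N) - sigma(m)) + N c(m),
   where sigma(x) = 0 for non-integral x and 24 l_N = e (N^2 - 1).  Since n_N
   divides l_N, e - 1 and N - 1, the congruence
   c(m) = sigma(m) - N sigma(m / N) modulo n_N makes b an integer, and
   n_N (a - b) is a multiple of N while n_N is prime to N.  That sigma_N(m) is
   sigma(m) - N sigma(m / N) relies on the uniqueness of q-expansions. *)

Require Import Defs.
From mathcomp Require Import all_boot all_order all_algebra all_fingroup.
From mathcomp Require Import mxrepresentation.
From mathcomp Require Import complex.
From mathcomp Require Import all_classical all_reals all_analysis.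
From mathcomp Require Import ring lra zify.

Set Implicit Arguments.
Unset Strict Implicit.
Unset Printing Implicit Defensive.

Import Order.TTheory GRing.Theory Num.Theory.
Import numFieldNormedType.Exports.

Local Open Scope classical_set_scope.
Local Open Scope ring_scope.

(** * Characters of the cyclic group and two-valued virtual characters *)

(** A root of [1 + X + ... + X^(p-1)] has order dividing [p]. Order 1 would make the root equal to
    1, where the polynomial takes the nonzero value [p]. *)
Lemma prime_prim_root_exists (F : closedFieldType) (p : nat) :
  prime p -> p%:R != 0 :> F -> exists z : F, p.-primitive_root z.
Proof.
move=> pp p_neq0; set P : {poly F} := \poly_(i < p) 1.
have szP : size P = p by apply: size_poly_eq; rewrite oner_eq0.
have [z /rootP Pz] : exists z, root P z.
  by apply/closed_rootP; rewrite szP neq_ltn prime_gt1 ?orbT.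
have {Pz} sz : \sum_(i < p) z ^+ i = 0.
  by rewrite -[RHS]Pz horner_poly; apply: eq_bigr => i _; rewrite mul1r.
have zp : z ^+ p = 1 by apply/eqP; rewrite -subr_eq0 subrX1 sz mulr0.
have [m mz mp] := prim_order_exists (prime_gt0 pp) zp.
exists z; have /primeP[_ /(_ m mp) /orP[/eqP m1|/eqP <-//]] := pp.
move: sz; rewrite (eq_bigr (fun=> 1)) => [|i _]; last first.
  by have := prim_expr_order mz; rewrite m1 expr1 => ->; rewrite expr1n.
by rewrite sumr_const card_ord => /eqP; rewrite (negPf p_neq0).
Qed.

Lemma sum_prim_root (F : fieldType) (p : nat) (z : F) (j : nat) :
  p.-primitive_root z ->
  \sum_(i < p) z ^+ (i * j) = if (p %| j)%N then p%:R else 0.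
Proof.
move=> pz; under eq_bigr do rewrite mulnC exprM.
have zj1 : (z ^+ j == 1) = (p %| j)%N by rewrite (prim_order_dvd pz).
case: ifPn => pj.
  move: zj1; rewrite pj => /eqP ->; under eq_bigr do rewrite expr1n.
  by rewrite sumr_const card_ord.
(* Geometric sum: multiplied by [z ^+ j - 1], which is nonzero here, it telescopes to
   [z ^+ (j * p) - 1 = 0]. *)
apply/eqP; rewrite -(mulrI_eq0 _ (mulfI _ : GRing.lreg (z ^+ j - 1))).
  by rewrite -subrX1 -exprM mulnC exprM (prim_expr_order pz) expr1n subrr.
by rewrite subr_eq0 zj1.
Qed.

Section CyclicCharacters.
Variables (F : fieldType) (N : nat) (z : F).
Hypotheses (N_gt1 : (1 < N)%N) (zN : z ^+ N = 1).

Definition cyclic_char (i : 'I_N) (x : 'Z_N) : 'M[F]_1 := (z ^+ (i * x))%:M.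

Lemma cyclic_char_repr i : mx_repr [set: 'Z_N]%G (cyclic_char i).
Proof.
split=> [|x y _ _]; first by rewrite /cyclic_char muln0.
rewrite /cyclic_char -scalar_mxM -exprD -mulnDr; congr (_ %:M).
rewrite -[RHS](expr_mod _ zN) -[LHS](expr_mod _ zN); congr (_ ^+ _).
(* The modulus built into ['Z_N] agrees with [N] only through [Zp_cast], hence the need for
   [1 < N]. *)
have -> : (x * y)%g = ((x + y) %% N)%N :> nat.
  by congr (_ %% _)%N; exact: Zp_cast.
by rewrite modnMmr.
Qed.

Lemma cyclic_char_irr i :
  mx_irreducible (MxRepresentation (cyclic_char_repr i)).
Proof. exact/mx_abs_irrW/linear_mx_abs_irr. Qed.

End CyclicCharacters.

Lemma virtual_rep_exists (F : closedFieldType) (N : nat) (a b : int) :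
  prime N -> N%:R != 0 :> F -> (N%:Z %| a - b)%Z ->
  exists V : virtual_rep F [set: 'Z_N]%G,
    forall x, vtrace V x = (if x == 0 then a else b)%:~R.
Proof.
move=> pN N0 /dvdzP[k abk].
have [z zprim] := prime_prim_root_exists pN N0.
have N1 := prime_gt1 pN; have zN := prim_expr_order zprim.
have N_gt0 := prime_gt0 pN.
(* The regular representation is entered as the sum of all [N] linear characters, so each gets
   coefficient [k]; the trivial one, [i = 0], gets [b] more. *)
exists (VirtualRep (fun i : 'I_N => (i == 0%N :> nat)%:R * b + k)
         (cyclic_char_irr N1 zN)) => x.
rewrite /vtrace /= (eq_bigr (fun i : 'I_N =>
  (i == 0%N :> nat)%:R * b%:~R + k%:~R * z ^+ (i * x))); last first.
  move=> i _; rewrite mxtrace_scalar mulr1n intrD intrM mulrDl.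
  by case: eqP => [->|_]; rewrite ?expr0 /= ?mulr1 ?mul0r.
rewrite big_split /= -mulr_sumr (sum_prim_root _ zprim).
rewrite (bigD1 (Ordinal N_gt0)) //= mul1r big1 ?addr0; last first.
  by move=> i; rewrite -val_eqE /= => /negPf ->; rewrite mul0r.
have -> : (N %| x)%N = (x == 0).
  have := ltn_ord x; rewrite [X in (_ < X)%N](Zp_cast N1) => xN.
  by rewrite -val_eqE /= /dvdn modn_small.
case: eqP => _; last by rewrite mulr0 addr0.
by rewrite -[N%:R]/(N%:Z%:~R) -intrM -intrD -abk addrC subrK.
Qed.

(** * Arithmetic of [nN] and [lN] *)

Lemma numq_div_nat (a m : nat) : (0 < m)%N ->
  exists d : int, [/\ d != 0, coprimez (numq (a%:R / m%:R)) d
    & m%:Z * numq (a%:R / m%:R) = a%:Z * d].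
Proof.
move=> m0; set x : rat := _ / _; exists (denq x); split.
- exact: denq_neq0.
- exact: coprime_num_den.
- apply/eqP; rewrite -(eqr_int rat) !intrM numqE /x; apply/eqP.
  have : m%:R != 0 :> rat by rewrite pnatr_eq0 -lt0n.
  rewrite !pmulrn => ?.
  by rewrite mulrA; congr (_ * _); rewrite mulrC divfK.
Qed.

(** The witness [d] is the denominator of [(N - 1) / 12], and [k] is the gcd of [N - 1] and 12. By
    Gauss [d] divides 12, being prime to [nN N] and a divisor of [12 * nN N]. *)
Lemma nN_dvd (N : nat) : (0 < N)%N ->
  exists k d : int, [/\ N%:Z - 1 = nN N * k, 12 = k * d & coprimez (nN N) d].
Proof.
move=> N0; have [d [d0 cop E]] := @numq_div_nat N.-1 12 isT.
have nE : nN N = numq (N.-1%:R / 12%:R).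
  by rewrite /nN -[in LHS](prednK N0) -[N.-1.+1]addn1 natrD addrK.
rewrite -nE in cop E.
have /dvdzP[k kE] : (d %| 12)%Z.
  rewrite -(@Gauss_dvdzl _ _ (nN N)); last by rewrite coprimez_sym.
  by apply/dvdzP; exists N.-1%:Z; rewrite E.
exists k, d; split=> //; apply: (mulIf d0).
have -> : N%:Z - 1 = N.-1%:Z by lia.
by rewrite -E kE; ring.
Qed.

Lemma prime_sqr_mod24 (N : nat) : prime N -> (3 < N)%N ->
  (N ^ 2 = 1 %[mod 24])%N.
Proof.
move=> pN N3.
have c2 : ~~ (2 %| N)%N by rewrite dvdn_prime2 // ; lia.
have c3 : ~~ (3 %| N)%N by rewrite dvdn_prime2 // ; lia.
have N2 : (N %% 24 %% 2 != 0)%N by rewrite modn_dvdm.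
have N3' : (N %% 24 %% 3 != 0)%N by rewrite modn_dvdm.
rewrite -modnXm; have : (N %% 24 < 24)%N by rewrite ltn_mod.
by move: (N %% 24)%N N2 N3'; do 24 case => //.
Qed.

(** The witness [e] is the denominator of [(N^2 - 1) / 24]: it is 8 for [N = 2], 3 for [N = 3], and
    1 for larger primes. In the two small cases [nN N = 1], so the divisibilities are trivial. *)
Lemma lN_nN_arith (N : nat) : prime N ->
  exists e : int, [/\ 24 * lN N = e * (N%:Z ^+ 2 - 1), (nN N %| lN N)%Z,
    (nN N %| e - 1)%Z & (nN N %| N%:Z - 1)%Z].
Proof.
move=> pN; have N0 := prime_gt0 pN; have [k [d [Nk kd cop]]] := nN_dvd N0.
have nN1 : (nN N %| N%:Z - 1)%Z by apply/dvdzP; exists k; rewrite Nk mulrC.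
have [N3|] := leqP N 3.
  have : (N == 2) || (N == 3).
    by move: pN N3; case: N {N0 Nk cop nN1} => [|[|[|[|]]]].
  by case/orP => /eqP ->; [exists 8 | exists 3]; split=> //; vm_compute.
move=> N3; exists 1.
have l24 : 24 * lN N = N%:Z ^+ 2 - 1.
  have /eqP := prime_sqr_mod24 pN N3; rewrite eqn_mod_dvd ?expn_gt0 ?N0 //.
  move=> /dvdnP[q qE].
  have qE' : N%:Z ^+ 2 - 1 = q%:Z * 24.
    by move: qE; rewrite -mulnn expr2 -PoszM; have := muln_gt0 N N; lia.
  rewrite qE' mulrC; congr (_ * _).
  have -> : lN N = numq q%:Z%:~R; last by rewrite numq_int.
  rewrite /lN -[N%:R ^+ 2 - 1]/(N%:Z%:~R ^+ 2 - 1) -rmorphXn -(rmorphB _ _ 1).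
  by rewrite /= qE' rmorphM mulfK.
split=> //; first by rewrite mul1r.
have [h hE] : exists h, N%:Z + 1 = 2 * h.
  exists (N.+1./2)%:Z; have := even_prime pN; lia.
(* Since [24 = 2 * k * d] and [N^2 - 1 = (nN N * k) * (2 * h)], cancelling [2 * k] leaves
   [d * lN N = h * nN N], with [d] prime to [nN N]. *)
rewrite -(@Gauss_dvdzr _ d) //; apply/dvdzP; exists h.
have k0 : k != 0 by apply: contra_eqN kd => /eqP ->; rewrite mul0r.
apply: (@mulfI _ (2 * k)); first by rewrite mulf_neq0.
have -> : 2 * k * (d * lN N) = 24 * lN N.
  by rewrite -[24]/(2 * 12 : int) kd; ring.
rewrite l24; have -> : N%:Z ^+ 2 - 1 = (N%:Z - 1) * (N%:Z + 1) by ring.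
by rewrite Nk hE; ring.
Qed.

(** * Formal operations on q-expansions *)

Section QExpansions.
Variable R : realType.
Implicit Types (f g : R[i] -> R[i]) (a b : nat -> R[i]) (t z : R[i]).

Lemma cexpD z w : cexp (z + w) = cexp z * cexp w :> R[i].
Proof.
case: z w => [x y] [u v]; rewrite /cexp /= expRD cosD sinD; apply/eqP.
by rewrite eq_complex /=; apply/andP; split; apply/eqP; ring.
Qed.

Lemma qexp_natmul (n : nat) t : qexp (n%:R * t) = qexp t ^+ n.
Proof.
elim: n => [|n IHn].
  by rewrite mul0r /qexp mulr0 /cexp /= expR0 cos0 sin0 mul1r expr0.
by rewrite -natr1 mulrDl mul1r exprSr -IHn /qexp mulrDr cexpD.
Qed.

Lemma norm_qexp t : `|qexp t| = (expR (- (2 * pi * complex.Im t)))%:C%C.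
Proof.
rewrite /qexp /cexp normrM ger0_norm ?ler0c ?expR_ge0 // normc_def.
rewrite cos2Dsin2 sqrtr1 mulr1; case: t => [x y] /=; congr (expR _)%:C%C; ring.
Qed.

Lemma norm_qexp_lt1 t : upper t ->
  exists2 r : R, 0 < r < 1 & `|qexp t| = r%:C%C.
Proof.
move=> ut; exists (expR (- (2 * pi * complex.Im t))); last exact: norm_qexp.
by rewrite expR_gt0 expR_lt1 oppr_lt0 !mulr_gt0 ?pi_gt0.
Qed.

(** Such a point lies on the imaginary axis. This lets q-expansions be compared through real power
    series on the interval from 0 to 1. *)
Lemma qexp_real (r : R) : 0 < r < 1 -> exists2 t, upper t & qexp t = r%:C%C.
Proof.
case/andP=> r0 r1; have pi0 := pi_gt0 R.
exists (Complex 0 (- ln r / (2 * pi))).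
  by rewrite /upper /= divr_gt0 ?mulr_gt0 // oppr_gt0 ln_lt0 // r0 r1.
rewrite /qexp /cexp /= !(mulr0, mul0r, subr0, add0r, addr0, mulr1).
rewrite oppr0 mul0r cos0 sin0 mulr1 [2 * pi * _]mulrC divfK; last first.
  by rewrite gt_eqF ?mulr_gt0.
by rewrite opprK lnK.
Qed.

Lemma has_qexp_ext f g a b : has_qexp f a ->
  (forall t, upper t -> g t = f t) -> (forall n, b n = a n) -> has_qexp g b.
Proof.
move=> fa gf ba t ut; rewrite gf //; have := fa t ut.
by rewrite (funext ba : b = a).
Qed.

Lemma has_qexp_lin (x y : R[i]) f g a b : has_qexp f a -> has_qexp g b ->
  has_qexp (fun t => x * f t + y * g t) (fun n => x * a n + y * b n).
Proof.
move=> fa gb t ut.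
have E n : \sum_(0 <= k < n) (x * a k + y * b k) * qexp t ^+ k =
    x * (\sum_(0 <= k < n) a k * qexp t ^+ k) +
    y * (\sum_(0 <= k < n) b k * qexp t ^+ k).
  rewrite !mulr_sumr -big_split /=; apply: eq_bigr => k _.
  by rewrite mulrDl !mulrA.
rewrite (eq_cvg _ _ E); apply: (@cvgD _ R[i]^o).
  exact: (cvgZ (@cvg_cst R[i]^o x _ _ _) (fa t ut)).
exact: (cvgZ (@cvg_cst R[i]^o y _ _ _) (gb t ut)).
Qed.

Lemma has_qexp_cst (x : R[i]) :
  has_qexp (fun=> x) (fun n => x * (n == 0)%N%:R).
Proof.
move=> t ut; apply: cvg_near_cst; exists 1%N => // n /= n0.
rewrite big_ltn // big_nat_cond big1 => [|k]; last first.
  by rewrite andbT => /andP[k0 _]; rewrite gtn_eqF // mulr0 mul0r.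
by rewrite eqxx expr0 !mulr1 addr0.
Qed.

(** The operator usually written [V_N], which substitutes [q^N] for [q] in a power series. *)
Definition dilate_coef (N : nat) (a : nat -> R[i]) (n : nat) : R[i] :=
  if (N %| n)%N then a (n %/ N)%N else 0.

(** The number of multiples of [N] below [n] is [n / N] rounded up, which is [(n + N.-1) %/ N]. It
    grows by one from [n] to [n.+1] exactly when [N] divides [n]. *)
Lemma sum_dilate_coef (N : nat) a z (n : nat) : (0 < N)%N ->
  \sum_(0 <= k < n) dilate_coef N a k * z ^+ k =
  \sum_(0 <= k < (n + N.-1) %/ N) a k * (z ^+ N) ^+ k.
Proof.
move=> N0; elim: n => [|n IHn]; first by
  rewrite add0n divn_small ?prednK // !big_nil.
rewrite big_nat_recr //= IHn /dilate_coef.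
have -> : ((n.+1 + N.-1) %/ N = (n %/ N).+1)%N.
  by rewrite addSnnS prednK // -{1}[N]mul1n addnC divnMDl.
case: ifPn => [/dvdnP[q ->]|nd].
  rewrite mulnK // divnMDl // divn_small ?prednK // addn0.
  by rewrite big_nat_recr //= -exprM mulnC.
rewrite mul0r addr0; congr (\sum_(0 <= k < _) _).
have := divn_eq n N; have := ltn_pmod n N0.
move: nd; rewrite /dvdn; set r := (n %% N)%N; set q := (n %/ N)%N => r0 rN ->.
have -> : (q * N + r + N.-1 = q.+1 * N + r.-1)%N by rewrite mulSn; lia.
by rewrite divnMDl // divn_small ?addn0 //; lia.
Qed.

Lemma has_qexp_dilate (N : nat) f a : (0 < N)%N -> has_qexp f a ->
  has_qexp (fun t => f (N%:R * t)) (dilate_coef N a).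
Proof.
move=> N0 fa t ut.
have uNt : upper (N%:R * t).
  move: ut; rewrite /upper mulr_natl; case: t => x y /= y0.
  by rewrite raddfMn /= pmulrn_lgt0.
have := fa _ uNt; rewrite qexp_natmul => lim.
(* The dilated partial sums are those of [f] at [N * t], reindexed by a sequence tending to
   infinity. *)
have sub : (fun n => ((n + N.-1) %/ N)%N) @ \oo --> \oo.
  move=> A [m _ mA]; exists (m * N)%N => // n /= mn.
  by apply: mA => /=; rewrite leq_divRL // (leq_trans mn) ?leq_addr.
rewrite (eq_cvg _ _ (fun n => sum_dilate_coef a _ n N0)).
exact: cvg_comp sub lim.
Qed.

End QExpansions.

(** * Real power series: a convergence bound and the identity theorem *)

Section RealSeries.
Variable R : realType.
Implicit Types (u : nat -> R) (r s : R).

(** Each of the [n] terms [s ^+ i] with [i < n] is at least [s ^+ n], and their sum is below the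
    full geometric series. *)
Lemma natmul_exp_bound s (n : nat) : 0 < s < 1 -> n%:R * s ^+ n <= (1 - s)^-1.
Proof.
case/andP=> s0 s1; have s1' : `|s| < 1 by rewrite gtr0_norm.
have := geometric_le_lim n ler01 s0 s1'; rewrite mul1r.
apply: le_trans; rewrite /series /= mulr_natl -{2}(card_ord n) -sumr_const big_mkord.
 apply: ler_sum => i _.
by rewrite mul1r ler_wiXn2l ?(ltW s0) ?(ltW s1) ?(ltnW (ltn_ord i)).
Qed.

Lemma is_cvg_sqr_natmul_exp r : 0 < r < 1 ->
  cvgn (series (fun n : nat => (n ^ 2)%:R * r ^+ n)).
Proof.
(* With [s] the fourth root of [r], the term is [(n * s^n)^2 * (s^2)^n]: a bounded factor times a
   geometric one. *)
case/andP=> r0 r1; pose s := Num.sqrt (Num.sqrt r).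
have s0 : 0 < s by rewrite !sqrtr_gt0.
have s4 : s ^+ 4 = r by rewrite (exprM s 2 2) !sqr_sqrtr ?sqrtr_ge0 // ltW.
have s1 : s < 1 by rewrite -(@expr_lt1 _ 4) ?s4 // ltW.
have s2 : `|s ^+ 2| < 1 by rewrite ger0_norm ?expr_lt1 ?exprn_ge0 ?ltW.
have u_ge0 n : 0 <= (n ^ 2)%:R * r ^+ n by rewrite mulr_ge0 ?exprn_ge0 ?(ltW r0).
have v_ge0 n : 0 <= geometric ((1 - s)^-1 ^+ 2) (s ^+ 2) n.
  by rewrite geometric_ge0 ?exprn_ge0 ?invr_ge0 ?subr_ge0 ?ltW.
apply: (series_le_cvg u_ge0 v_ge0) (is_cvg_geometric_series s2) => n /=.
have -> : (n ^ 2)%:R * r ^+ n = (n%:R * s ^+ n) ^+ 2 * (s ^+ 2) ^+ n.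
  by rewrite natrX -s4 [in RHS]exprMn -!exprM -[RHS]mulrA -exprD; congr (_ * s ^+ _); lia.
apply: ler_wpM2r; first by rewrite !exprn_ge0 ?ltW.
rewrite lerXn2r ?nnegrE //.
- by rewrite mulr_ge0 ?exprn_ge0 ?(ltW s0).
- by rewrite invr_ge0 subr_ge0 ltW.
- by rewrite natmul_exp_bound ?s0.
Qed.

(** Convergence at [1/2] bounds [u k] by [M * 2^k]. For small [r] the tail from index 1 is then at
    most [4 * M * r], and it must cancel [u 0]; letting [r] be small forces [u 0 = 0]. *)
Lemma pseries_eq0_coef0 u :
  (forall r, 0 < r < 1 -> pseries u r @ \oo --> (0 : R)) -> u 0%N = 0.
Proof.
move=> u0; have /cvgP/cvg_series_bounded[K [_ uK]] := u0 (2^-1) ltac:(lra).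
pose M := `|K| + 1.
have uM k : `|u k| <= M * 2 ^+ k.
  have KM : K < M by rewrite /M ltr_pwDr ?ler_norm.
  have /= := uK M KM k I.
  by rewrite normrM normrX normfV normr_nat exprVn ler_pdivrMr ?exprn_gt0.
have M0 : 0 < M by rewrite ltr_pwDr.
have bound r : 0 < r < 4^-1 -> `|u 0%N| <= 4 * M * r.
  case/andP=> r0 r4.
  have r1 : 0 < r < 1 by lra.
  have r2 : `|2 * r| < 1 by rewrite gtr0_norm; lra.
  have lim : `|pseries u r n.+1 - u 0%N| @[n --> \oo] --> `|0 - u 0%N|.
    apply: cvg_norm; apply: cvgB; last exact: cvg_cst.
    by have := u0 r r1; rewrite -cvg_shiftS.
  rewrite -normrN -sub0r.
  apply: (ler_cvg_to lim (cvg_cst (4 * M * r))).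
  apply: nearW => n; rewrite /pseries /series /= big_nat_recl // expr0 mulr1.
  rewrite addrC addKr (le_trans (ler_norm_sum _ _ _)) //.
  have /(le_trans _) -> // : series (geometric (2 * M * r) (2 * r)) n <= 4 * M * r.
    have a0 : 0 <= 2 * M * r by rewrite ltW ?mulr_gt0.
    apply: le_trans (geometric_le_lim n a0 (mulr_gt0 (ltr0Sn _ _) r0) r2) _.
    by rewrite ler_pdivrMr; [nra | lra].
  apply: ler_sum => k _; rewrite normrM normrX (gtr0_norm r0).
  apply: le_trans (ler_wpM2r (exprn_ge0 _ (ltW r0)) (uM _)) _.
  by rewrite /= exprMn !exprS le_eqVlt; apply/orP; left; apply/eqP; ring.
apply/eqP; rewrite -normr_eq0 eq_le normr_ge0 andbT leNgt; apply/negP => u_gt0.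
have := uM 0%N; rewrite expr0 mulr1 => uM0.
(* This radius is at most [1/8] because [u 0] is bounded by [M], and it turns the bound into half of
   the norm of [u 0], a contradiction. *)
have := bound (`|u 0%N| / (8 * M)); rewrite divr_gt0 ?mulr_gt0 //=.
rewrite ltr_pdivrMr ?mulr_gt0 // => /(_ ltac:(lra)).
have -> : 4 * M * (`|u 0%N| / (8 * M)) = `|u 0%N| / 2 by field; rewrite gt_eqF.
by lra.
Qed.

Lemma pseries_eq0_coef u :
  (forall r, 0 < r < 1 -> pseries u r @ \oo --> (0 : R)) -> forall n, u n = 0.
Proof.
move=> u0 n; elim: n u u0 => [|n IHn] u u0; first exact: pseries_eq0_coef0.
apply: (IHn (fun k => u k.+1)) => r r01.
have c0 := pseries_eq0_coef0 u0.
(* Once the constant term vanishes, dividing by [r] shifts the series, so the induction hypothesis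
   applies to the shifted coefficients. *)
have E k : pseries (fun k => u k.+1) r k = r^-1 * pseries u r k.+1.
  rewrite /pseries /series /= big_nat_recl // c0 mul0r add0r mulr_sumr.
  by apply: eq_bigr => i _; rewrite exprS mulrCA mulKf //; lra.
have lim : pseries u r k.+1 @[k --> \oo] --> (0 : R).
  by have := u0 r r01; rewrite -cvg_shiftS.
have := cvgM (cvg_cst (r^-1 : R)) lim; rewrite mulr0 => L.
by rewrite (eq_cvg _ _ E); exact: L.
Qed.

End RealSeries.

(** * Complex series, uniqueness of q-expansions and the expansion of [E2] *)

Section ComplexSeries.
Variable R : realType.
Implicit Types (u : nat -> R[i]) (v : nat -> R).

Lemma cvg_complex_Re u (l : R[i]) : (u : nat -> R[i]^o) @ \oo --> (l : R[i]^o) ->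
  (fun n => complex.Re (u n)) @ \oo --> complex.Re l.
Proof.
move=> /cvgrPdist_lt ul; apply/cvgrPdist_lt => e e0.
have := ul e%:C%C; rewrite ltcR => /(_ e0); apply: filterS => n.
rewrite -ltcR; apply: le_lt_trans.
by rewrite -(raddfB (@complex.Re R)) normc_ge_Re.
Qed.

Lemma cvg_real_complex v (l : R) : v @ \oo --> l ->
  (fun n => (v n)%:C%C : R[i]^o) @ \oo --> (l%:C%C : R[i]^o).
Proof.
move=> /cvgrPdist_lt vl; apply/cvgrPdist_lt => -[e e'].
rewrite ltcE /= => /andP[/eqP -> e0].
apply: filterS (vl e e0) => n /=; rewrite -rmorphB /= normc_def /=.
by rewrite expr0n addr0 sqrtr_sqr ltcR.
Qed.

Lemma is_cvg_series_complex u v : (forall n, `|u n| <= (v n)%:C%C) ->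
  cvgn (series v) -> cvgn (series (u : nat -> R[i]^o)).
Proof.
move=> uv cv; have v_ge0 n : 0 <= v n.
  by rewrite -ler0c (le_trans _ (uv n)).
have cRe (w : nat -> R[i]) : (forall n, `|w n| <= (v n)%:C%C) ->
    cvgn (series (fun n => complex.Re (w n))).
  move=> wv; apply: normed_cvg.
  apply: (series_le_cvg (fun=> normr_ge0 _) v_ge0 _ cv) => n.
  by rewrite -lecR (le_trans (normc_ge_Re _)).
(* The real part of [w n] is minus the imaginary part of [u n], so one argument on real parts covers
   both components. *)
pose w n := u n * 'i%C.
have wv n : `|w n| <= (v n)%:C%C.
  rewrite normrM (_ : `|'i%C| = 1) ?mulr1 // normc_def /=.
  by rewrite expr0n expr1n add0r sqrtr1.
have := cvgB (cvg_real_complex (cRe u uv))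
  (cvgZ (@cvg_cst R[i]^o 'i%C _ _ _) (cvg_real_complex (cRe w wv))).
have E n : series (u : nat -> R[i]^o) n =
    (series (fun n => complex.Re (u n)) n)%:C%C -
    'i%C * (series (fun n => complex.Re (w n)) n)%:C%C.
  rewrite /series /= !rmorph_sum mulr_sumr -sumrB; apply: eq_bigr => k _ /=.
  by rewrite /w ReiNIm rmorphN mulrN opprK -complexE.
by move=> L; apply/cvg_ex; eexists; rewrite (eq_cvg _ _ E); exact: L.
Qed.

(** At real values of [q] the real part of the series is a real power series in the real parts of
    the coefficients, so these vanish. Multiplying the coefficients by ['i] handles the imaginary
    parts. *)
Lemma has_qexp0_coef (a : nat -> R[i]) :
  has_qexp (fun=> 0) a -> forall n, a n = 0.
Proof.
have Re0 (b : nat -> R[i]) : has_qexp (fun=> 0) b -> forall n, complex.Re (b n) = 0.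
  move=> b0; apply: pseries_eq0_coef => r /qexp_real[t ut tr].
  have E n : pseries (fun k => complex.Re (b k)) r n =
      complex.Re (\sum_(0 <= k < n) b k * qexp t ^+ k).
    rewrite tr raddf_sum; apply: eq_bigr => k _ /=.
    by rewrite -rmorphXn /=; case: (b k) => x y /=; rewrite mulr0 subr0.
  by rewrite (eq_cvg _ _ E); exact: cvg_complex_Re (b0 t ut).
move=> a0 n.
have ia0 : has_qexp (fun=> 0) (fun n => 'i%C * a n).
  refine (has_qexp_ext (has_qexp_lin (x := 'i%C) (y := 0) a0 a0) _ _) => [t _|k];
  by rewrite ?mulr0 ?mul0r addr0.
have := Re0 _ a0 n; have := Re0 _ ia0 n; rewrite mulrC ReiNIm.
case: (a n) => x y /= /eqP; rewrite oppr_eq0 => /eqP -> -> //.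
Qed.

Lemma has_qexp_uniq (f : R[i] -> R[i]) (a b : nat -> R[i]) :
  has_qexp f a -> has_qexp f b -> a =1 b.
Proof.
move=> fa fb n; apply/eqP; rewrite -subr_eq0; apply/eqP.
apply: (@has_qexp0_coef (fun n => a n - b n)).
by refine (has_qexp_ext (has_qexp_lin (x := 1) (y := -1) fa fb) _ _) => [t _|k];
  rewrite mulN1r mul1r ?subrr.
Qed.

(* [divisors 0 = [:: 1]], hence [sigma1 0 = 1]. *)
Definition sigma1' (n : nat) : nat := if n == 0%N then 0%N else sigma1 n.

(** There are at most [n] divisors, each at most [n]. This crude bound suffices to dominate the
    series of [E2]. *)
Lemma sigma1'_le (n : nat) : (sigma1' n <= n ^ 2)%N.
Proof.
have [->|n0] := posnP n; first by [].
have dn d : d \in divisors n -> (0 < d <= n)%N.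
  by rewrite -dvdn_divisors // => dn; rewrite (dvdn_gt0 n0 dn) (dvdn_leq n0 dn).
have -> : sigma1' n = (\sum_(d <- divisors n) d)%N by rewrite /sigma1' gtn_eqF.
have /leq_trans -> // : (\sum_(d <- divisors n) d <= size (divisors n) * n)%N.
  rewrite mulnC -iter_addn_0 -count_predT -big_const_seq big_seq [leqRHS]big_seq.
  by apply: leq_sum => d /dn /andP[].
rewrite -mulnn leq_mul2r; apply/orP; right.
rewrite -[leqRHS](size_iota 1) uniq_leq_size ?divisors_uniq // => d /dn.
by rewrite mem_iota add1n ltnS.
Qed.

Lemma has_qexp_E2 : has_qexp (@E2 R)
  (fun n => (n == 0)%N%:R - 24 * (sigma1' n)%:R).
Proof.
pose f (t : R[i]) : R[i] :=
  \big[+%R/0]_(1 <= n <oo) ((sigma1 n)%:R * qexp t ^+ n : R[i]^o).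
have fE : has_qexp f (fun n => (sigma1' n)%:R).
  move=> t ut; have [r r01 qr] := norm_qexp_lt1 ut.
  have cv : cvgn (series (fun n => (sigma1' n)%:R * qexp t ^+ n : R[i]^o)).
    apply: is_cvg_series_complex (is_cvg_sqr_natmul_exp r01) => n.
    rewrite normrM normrX qr normr_nat -rmorphXn rmorphM /= rmorph_nat.
    rewrite ler_wpM2r ?ler_nat ?sigma1'_le // ler0c exprn_ge0 //.
    by case/andP: r01 => /ltW.
  (* The infinite sum in [E2] is a limit of partial sums starting at index 1. They match those
     starting at 0 because [sigma1' 0 = 0], and convergence [cv] then gives the claim. *)
  rewrite /f; suff <- : series (fun n => (sigma1' n)%:R * qexp t ^+ n : R[i]^o) =
    (fun n => \sum_(1 <= k < n) (sigma1 k)%:R * qexp t ^+ k : R[i]^o) by exact: cv.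
  apply: funext => -[|n]; rewrite /series /=; first by rewrite !big_geq.
  rewrite big_ltn // mul0r add0r big_nat_cond [RHS]big_nat_cond.
  by apply: eq_bigr => k; rewrite andbT => /andP[k0 _]; rewrite /sigma1' gtn_eqF.
refine (has_qexp_ext (has_qexp_lin (x := 1) (y := -24) (has_qexp_cst (x := 1)) fE) _ _) => [t _|n].
  by rewrite mul1r mulNr.
by rewrite !mul1r mulNr.
Qed.

End ComplexSeries.

(** * Integrality of the trace values, and assembly *)

(** In the application [delta] is 1 at index 0 and 0 elsewhere, [sig] and [sigN] are the divisor
    sums at [m] and [m / N], and [c] is the coefficient of [g]. The pair consists of the traces at
    the identity and away from it. *)
Lemma trace_values_exist (N n l e delta sig sigN c : int) :
  n != 0 -> 24 * l = e * (N ^+ 2 - 1) ->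
  (n %| l)%Z -> (n %| e - 1)%Z -> (n %| N - 1)%Z ->
  (n %| c - (sig - N * sigN))%Z ->
  exists ab : int * int,
    [/\ n * ab.1 = - l * (delta - 24 * sig),
        n * ab.2 = - l * delta + e * (N ^+ 2 * sigN - sig) + N * c
      & (N %| ab.1 - ab.2)%Z].
Proof.
move=> n0 l24 /dvdzP[k lE] /dvdzP[j eE] /dvdzP[q NE] /dvdzP[i cE].
have aE : n * (- k * (delta - 24 * sig)) = - l * (delta - 24 * sig).
  by rewrite lE; ring.
have bE : n * (- k * delta + j * (N ^+ 2 * sigN - sig) + q * sig + N * i) =
    - l * delta + e * (N ^+ 2 * sigN - sig) + N * c.
  have -> : N * c = N * (i * n) + N * (sig - N * sigN) by rewrite -cE; ring.
  have -> : e = j * n + 1 by rewrite -eE; ring.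
  transitivity (- l * delta + (j * n + 1) * (N ^+ 2 * sigN - sig) +
    (q * n - N + 1) * sig + N * (i * n) + N * (sig - N * sigN)).
    by rewrite lE; ring.
  by rewrite -NE; ring.
move: aE bE; set a := - k * _; set b := _ + N * i => aE bE.
exists (a, b); split=> //=; apply/dvdzP.
have nab : n * (a - b) = N * (e * N * sig - e * N * sigN - c).
  have -> : n * (a - b) =
      24 * l * sig - e * (N ^+ 2 * sigN - sig) - N * c.
    by rewrite mulrBr aE bE; ring.
  by rewrite l24; ring.
(* Bezout: [N - q * n = 1], so [a - b] equals [N * (a - b) - q * (n * (a - b))], and [n * (a - b)]
   is a multiple of [N] by [nab]. *)
exists (a - b - q * (e * N * sig - e * N * sigN - c)).
transitivity (N * (a - b) - q * (n * (a - b))); last by rewrite nab; ring.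
by rewrite mulrA -NE; ring.
Qed.

(** Solves the integral equation for [b] over a field. The right-hand side, including the factor
    [-1], has the shape that [has_qexp_lin] produces for [f_g]. *)
Lemma trace_value_eq (F : numFieldType) (N n l e delta sig sigN c b : F) :
  n != 0 -> N + 1 != 0 -> N - 1 != 0 -> 24 * l = e * (N ^+ 2 - 1) ->
  n * b = - l * delta + e * (N ^+ 2 * sigN - sig) + N * c ->
  b = - (l / n) * ((N + 1) * (N - 1))^-1 *
      (N ^+ 2 * (delta - 24 * sigN) + -1 * (delta - 24 * sig)) + N / n * c.
Proof.
move=> n0 Np Nm l24 bE; apply: (mulfI n0); rewrite bE.
have -> : l = e * (N ^+ 2 - 1) / 24 by rewrite -l24 mulrC mulKf ?pnatr_eq0.
by field; rewrite n0 Np Nm.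
Qed.

Lemma is_sigmaN_eq (R : realType) (N : nat) (s : nat -> int) (m : nat) :
  (0 < N)%N -> is_sigmaN R N s -> (0 < m)%N ->
  s m = (sigma1' m)%:Z -
        N%:Z * (if (N %| m)%N then sigma1' (m %/ N) else 0%N)%:Z.
Proof.
move=> N0 sN m0; have [a fa am] := sN m m0.
have E2R := has_qexp_E2 (R := R); have E2NR := has_qexp_dilate N0 E2R.
have L := has_qexp_lin (x := 24^-1 * N%:R) (y := - 24^-1) E2NR E2R.
have fL (t : R[i]) : upper t -> 24^-1 * (N%:R * E2 (N%:R * t) - E2 t) =
    24^-1 * N%:R * E2 (N%:R * t) + - 24^-1 * E2 t.
  by move=> _; rewrite mulrBr mulrA mulNr.
have := has_qexp_uniq fa (has_qexp_ext L fL (frefl _)) m.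
rewrite /dilate_coef (gtn_eqF m0) => sE.
apply: (@intr_inj R[i]); rewrite -am sE rmorphB rmorphM /= -!pmulrn.
case: ifP => [Nm|_]; last by field.
(* Here [m %/ N] is positive, so the constant term of [E2] does not contribute. *)
by rewrite gtn_eqF ?divn_gt0 ?(dvdn_leq m0 Nm) //=; field.
Qed.

Theorem theorem2 (R : realType) (N : nat) (hN : prime N)
    (G : R[i] -> R[i]) (hG : is_GN N G) :
  exists V : nat -> virtual_rep R[i] [set: 'Z_N]%G,
    forall x : 'Z_N, has_qexp (fN G x) (fun n => vtrace (V n) x).
Proof.
have N0 := prime_gt0 hN; have N1 := prime_gt1 hN.
have [g [c [s [_ [c0 gc] sN cs Gg]]]] := hG.
have [e [l24 nl ne nN1]] := lN_nN_arith hN.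
have n0 : nN N != 0.
  apply: contraTneq nN1 => ->; rewrite dvd0z; lia.
pose sigN m := if (N %| m)%N then sigma1' (m %/ N) else 0%N.
(* The congruence on [c] is given for positive [m] only; at 0 both sides vanish, so all indices can
   be treated alike. *)
have cong m : (nN N %| c m - ((sigma1' m)%:Z - N%:Z * (sigN m)%:Z))%Z.
  case: m => [|m]; first by rewrite c0 /sigN dvdn0 div0n /= mulr0 subrr dvdz0.
  by rewrite /sigN -(is_sigmaN_eq N0 sN) // -eqz_mod_dvd; apply/eqP; exact: cs.
have ab m := trace_values_exist (m == 0%N)%:R n0 l24 nl ne nN1 (cong m).
have NR0 : N%:R != 0 :> R[i] by rewrite pnatr_eq0 -lt0n.
have nR0 : (nN N)%:~R != 0 :> R[i] by rewrite intr_eq0.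
(* The trace values are chosen together with the representation, so that their defining equations
   remain available when coefficients are compared. *)
have /choice[h hP] m : exists abV : (int * int) * virtual_rep R[i] [set: 'Z_N]%G,
    [/\ nN N * abV.1.1 = - lN N * ((m == 0%N)%:R - 24 * (sigma1' m)%:Z),
        nN N * abV.1.2 = - lN N * (m == 0%N)%:R +
          e * (N%:Z ^+ 2 * (sigN m)%:Z - (sigma1' m)%:Z) + N%:Z * c m
      & forall x, vtrace abV.2 x = (if x == 0 then abV.1.1 else abV.1.2)%:~R].
  have [[a b] /= [aE bE abN]] := ab m.
  by have [V VE] := virtual_rep_exists hN NR0 abN; exists ((a, b), V).
exists (fun m => (h m).2) => x; rewrite /fN.
have E2R := has_qexp_E2 (R := R).
case: (eqVneq x 0) => [x0|x0].
  refine (has_qexp_ext (has_qexp_lin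
    (x := - ((lN N)%:~R / (nN N)%:~R)) (y := 0) E2R E2R) _ _) => [t _|m].
    by rewrite mul0r addr0.
  have [aE _ ->] := hP m; rewrite x0 eqxx mul0r addr0; apply: (mulfI nR0).
  rewrite -intrM aE rmorphM rmorphN rmorphB rmorphM /= !rmorph_nat.
  by rewrite [RHS]mulrA mulrN [_ * (_ / _)]mulrCA mulfV // mulr1.
have H := has_qexp_lin (x := N%:R ^+ 2) (y := -1) (has_qexp_dilate N0 E2R) E2R.
(* The sign in front of [N / n_N] is positive because [G] is minus [g]. *)
refine (has_qexp_ext (has_qexp_lin
  (x := - ((lN N)%:~R / (nN N)%:~R) * ((N%:R + 1) * (N%:R - 1))^-1)
  (y := N%:R / (nN N)%:~R) H gc) _ _) => [t ut|m].
  by rewrite /E2N Gg // mulN1r mulrN opprK mulrA.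
have [_ bE ->] := hP m; rewrite (negPf x0).
have -> : dilate_coef N (fun n : nat => (n == 0%N)%:R - 24 * (sigma1' n)%:R) m =
    (m == 0%N)%:R - 24 * (sigN m)%:R :> R[i].
  rewrite /dilate_coef /sigN; case: ifP => [/dvdnP[k ->]|].
    by rewrite mulnK // muln_eq0 [(N == 0)%N]gtn_eqF ?orbF.
  (* If [N] does not divide [m], then [m] is nonzero and both sides are 0. *)
  by case: m {bE} => [|m _]; rewrite ?dvdn0 //= mulr0 subrr.
apply: (@trace_value_eq _ _ _ _ e%:~R) => //.
- by rewrite subr_eq0 (eqr_nat _ N 1) gtn_eqF.
- have := congr1 (fun z : int => z%:~R : R[i]) l24.
  by rewrite /= !rmorphM rmorphB rmorphXn /= !rmorph_nat.
have := congr1 (fun z : int => z%:~R : R[i]) bE.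
by rewrite /= !(rmorphD, rmorphM, rmorphB, rmorphN, rmorphXn) /= !rmorph_nat.
Qed.
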